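(* Let $q$ be an odd prime power and $d\ge 2$ an integer. Let $A,B\subset\mathbb{F}_q^d$. Then there exists $E\subset O(d)$ with $$|E|\ll\frac{|O(d-1)|\,q^{2d}}{|A||B|}$$ such that for every $g\in O(d)\setminus E$ there are at least $\gg q^d$ elements $z\in\mathbb{F}_q^d$ satisfying $$|A\cap(g(B)+z)|\sim\frac{|A||B|}{q^d}.$$
   Context: $\mathbb{F}_q$ is the finite field with $q$ elements. $O(n)$ is the group of $n\times n$ orthogonal matrices over $\mathbb{F}_q$ (those preserving $\|x\|=x_1^2+\cdots+x_n^2$). $g(B)+z=\{gb+z:b\in B\}$. $X\ll Y$ (equivalently $Y\gg X$) means $X\le CY$ for an absolute constant $C>0$; $X\sim Y$ means $X\ll Y$ and $Y\ll X$. Implicit constants may depend on $d$ only. *)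

(* Defs.v *)
From HB Require Import structures.
From mathcomp Require Import all_boot all_order all_algebra.
From mathcomp Require Import reals.

Set Implicit Arguments.
Unset Strict Implicit.
Unset Printing Implicit Defensive.

Import Order.TTheory GRing.Theory Num.Theory.
Local Open Scope ring_scope.

Definition qnorm (F : finFieldType) (n : nat) (x : 'cV[F]_n) : F :=
  \sum_(i < n) x i 0 ^+ 2.

(* The group O(n), as a finite set of matrices. In odd characteristic the
   polarization identity turns this condition into g^T *m g = 1%:M, so that
   every element is invertible. *)
Definition Ogroup (F : finFieldType) (n : nat) : {set 'M[F]_n} :=
  [set g : 'M[F]_n | [forall x : 'cV[F]_n, qnorm (g *m x) == qnorm x]].

Definition moved (F : finFieldType) (n : nat) (g : 'M[F]_n)
    (B : {set 'cV[F]_n}) (z : 'cV[F]_n) : {set 'cV[F]_n} :=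
  [set g *m b + z | b in B].

(* X << Y with implied constant C, and X ~ Y with implied constants C and C'. *)
Definition lesssim (R : realType) (C X Y : R) : bool := X <= C * Y.
Definition simeq (R : realType) (C C' X Y : R) : bool :=
  lesssim C X Y && lesssim C' Y X.

(* Main.v *)
Require Import Defs.
From HB Require Import structures.
From mathcomp Require Import all_boot all_order all_algebra.
From mathcomp Require Import fingroup finalg cyclic mxabelem.
From mathcomp Require Import reals.
From mathcomp Require Import ring lra zify.

Set Implicit Arguments.
Unset Strict Implicit.
Unset Printing Implicit Defensive.

Import Order.TTheory GRing.Theory Num.Theory.
Local Open Scope ring_scope.

(** For a rotation [g] put [r_g z = #|A :&: moved g B z|]; this counts the pairs
    of [A * B] with [a - g *m b = z], so its mean over [z] is
    [M = #|A| #|B| / q ^ d].  The heart of the proof is the averaged bound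
      [\sum_g \sum_z (r_g z - M)^2 <= C #|O(d-1)| q ^ d #|A| #|B|]
    of [sum_rotated_variance].  Granted this, Markov's inequality in [g] shows
    that the inner sum exceeds [M ^ 2 q ^ d / 8] only on a set [E] of the
    required size, and for [g] outside [E] Markov's inequality in [z]
    ([markov_card] both times) gives [M / 2 <= r_g z <= 3 M / 2] for at least
    half of all [z].

    The averaged bound is usually obtained by Plancherel.  Here characters are
    replaced by counting along hyperplanes.  For a real function [u] on
    [F ^ n] of mean zero, the squared sums of [u] over all affine hyperplanes
    add up to a constant multiple of the squared norm of [u] ([sum_energy]),
    because the number of hyperplane directions that fail to separate [x] from
    [y] depends only on whether [x = y].  Now [r_g - M] is the image of the
    discrepancy [u] of [A * B] in [F ^ 2d] under the linear map
    [(a, b) |-> a - g *m b], and its sums along [xi] are the sums of [u] along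
    [(xi, - xi *m g)].  Applying [sum_energy] in dimension [d], summing over
    [g], and replacing [- xi *m g] by a free vector [eta] reduces everything to
    [sum_energy] in dimension [2 d].

    The cost of that replacement is the number of [g] with
    [xi *m g = eta] for given [xi != 0], which must be at most a constant times
    [#|O(d-1)|] even if [xi] is isotropic.  Both quantities are compared with
    [q ^ 'C(d-1, 2)].  From above ([card_Ogroup_sending]): fix the vectors of a
    basis starting with [xi] one after the other; at each stage the possible images of the
    next vector satisfy independent linear equations and one quadratic equation
    which is not constant on their solutions, so it divides their number by at
    least [q / 2].  From below ([card_Ogroup_lb]): composing an element of
    [O(n)] with the reflections in the vectors [(1, x)] produces at least
    [q ^ n / 3] times as many elements of [O(n+1)]. *)

(** * Finite fields and the standard bilinear form *)

Lemma odd_card_natr2 (F : finFieldType) : odd #|F| -> 2%:R != 0 :> F.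
Proof.
move=> oddF; apply/eqP => F2; have := oner_neq0 F.
have: #|F|%:R = 0 :> F.
  by rewrite -FinRing.zmodXgE -cardsT; apply: expg_cardG; rewrite inE.
rewrite -[#|F|]odd_double_half oddF natrD -muln2 natrM F2 mulr0 addr0.
by move=> F0; rewrite -[1]/(true%:R : F) F0 eqxx.
Qed.

Section LinearAlgebra.
Variable F : finFieldType.

Lemma card_left_annihilator (n m : nat) (M : 'M[F]_(n, m)) :
  #|[set xi : 'rV_n | xi *m M == 0]| = (#|F| ^ (n - \rank M))%N.
Proof.
rewrite -mxrank_ker -card_rowg; apply: eq_card => xi.
by rewrite inE mem_rowg; apply/eqP/sub_kermxP.
Qed.

Lemma card_left_annihilator_cV (n : nat) (x : 'cV[F]_n) :
  #|[set xi : 'rV_n | xi *m x == 0]| =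
    (if (x == 0)%R then #|F| ^ n else #|F| ^ n.-1)%N.
Proof.
rewrite card_left_annihilator; case: eqP => [->|/eqP x0].
  by rewrite mxrank0 subn0.
have -> : \rank x = 1%N; last by rewrite subn1.
by apply/eqP; rewrite eqn_leq rank_leq_col lt0n mxrank_eq0.
Qed.

Definition dot (n : nat) (u v : 'rV[F]_n) : F := (u *m v^T) 0 0.

Lemma dotC n (u v : 'rV_n) : dot u v = dot v u.
Proof. by rewrite /dot -[in LHS](trmxK u) -trmx_mul mxE. Qed.
Lemma dotDl n (u v w : 'rV_n) : dot (u + v) w = dot u w + dot v w.
Proof. by rewrite /dot mulmxDl mxE. Qed.
Lemma dotZl n a (u v : 'rV_n) : dot (a *: u) v = a * dot u v.
Proof. by rewrite /dot -scalemxAl mxE. Qed.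
Lemma dotDr n (u v w : 'rV_n) : dot w (u + v) = dot w u + dot w v.
Proof. by rewrite dotC dotDl !(dotC w). Qed.
Lemma dotZr n a (u v : 'rV_n) : dot u (a *: v) = a * dot u v.
Proof. by rewrite dotC dotZl dotC. Qed.

Lemma qnorm_dot n (x : 'cV[F]_n) : qnorm x = dot x^T x^T.
Proof.
by rewrite /qnorm /dot mxE; apply: eq_bigr => i _; rewrite !mxE expr2.
Qed.

Hypothesis F2 : 2%:R != 0 :> F.

Lemma OgroupP n (g : 'M[F]_n) :
  reflect (g *m g^T = 1%:M) (g \in Ogroup F n).
Proof.
rewrite inE; apply: (iffP forallP) => [gO | ggT x]; last first.
  have gTg : g^T *m g = 1%:M by apply: mulmx1C.
  rewrite !qnorm_dot /dot trmxK trmx_mul mulmxA -(mulmxA x^T) gTg mulmx1.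
  by rewrite trmxK.
apply: mulmx1C.
have Q u : dot (u *m g^T) (u *m g^T) = dot u u.
  by have /eqP := gO u^T; rewrite !qnorm_dot trmx_mul !trmxK.
have P u v : dot (u *m g^T) (v *m g^T) = dot u v.
  have := Q (u + v).
  rewrite mulmxDl !(dotDl, dotDr) !Q !(dotC (v *m _)) (dotC v).
  move/eqP; rewrite -subr_eq0 => /eqP h.
  apply: (mulfI F2); apply/eqP; rewrite -subr_eq0 -h; apply/eqP; ring.
apply/matrixP => i j; have := P (delta_mx 0 i) (delta_mx 0 j).
rewrite /dot trmx_mul trmxK mulmxA -(mulmxA (delta_mx 0 i)).
rewrite !trmx_delta -!rowE -!colE [col _ _ _ _]mxE.
rewrite [row _ (_ *m _) _ _]mxE => ->.
by rewrite !mxE eqxx andbT.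
Qed.

Lemma OgroupM n (g h : 'M[F]_n) :
  g \in Ogroup F n -> h \in Ogroup F n -> g *m h \in Ogroup F n.
Proof.
move=> /OgroupP gO /OgroupP hO; apply/OgroupP.
by rewrite trmx_mul mulmxA -(mulmxA g) hO mulmx1.
Qed.

Lemma OgroupT n (g : 'M[F]_n) : g \in Ogroup F n -> g^T \in Ogroup F n.
Proof. by move=> /OgroupP gO; apply/OgroupP; rewrite trmxK; apply: mulmx1C. Qed.

Lemma card_quadratic_roots (a b c : F) :
    (a != 0) || (b != 0) ->
  (#|[set t : F | (a * t ^+ 2 + b * t + c == 0)%R]| <= 2)%N.
Proof.
move=> ab0; pose p : {poly F} := a *: 'X^2 + b *: 'X + c%:P.
have p0 : p != 0.
  apply: contraTneq ab0 => p0; rewrite negb_or !negbK; apply/andP; split.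
    have := congr1 (fun r : {poly F} => r`_2) p0.
    by rewrite /p !coefE /= mulr1 mulr0 !addr0 => ->.
  have := congr1 (fun r : {poly F} => r`_1) p0.
  by rewrite /p !coefE /= mulr1 mulr0 !addr0 add0r => ->.
have sp : (size p <= 3)%N.
  apply/leq_sizeP => -[|[|[|j]]] // _; rewrite /p !coefE /=.
  by rewrite !mulr0 !addr0.
rewrite cardE -ltnS; apply: leq_trans sp.
apply: max_poly_roots => //; last exact: enum_uniq.
apply/allP => t; rewrite mem_enum inE => /eqP rt.
by rewrite rootE /p !hornerE; apply/eqP; rewrite -[RHS]rt expr2 mulrA.
Qed.

(** [Y] is a union of lines in direction [u].  On the line through [y] the
    equation [dot v v = c] is polynomial of degree at most two in the
    parameter, with higher coefficients [dot u u] and [2 * dot y u]; as it is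
    not constant, the line contains at most two solutions.  The proof counts the
    pairs (parameter, solution) by the point of [Y] that they lead to. *)
Lemma card_quadric_lines n (Y : {set 'rV[F]_n}) (u : 'rV_n) (c : F) :
    (forall y t, y \in Y -> y + t *: u \in Y) ->
    (forall y, y \in Y -> (dot u u != 0) || (dot y u != 0)) ->
  (#|F| * #|[set y in Y | dot y y == c]| <= 2 * #|Y|)%N.
Proof.
move=> Ycl Yu; set X := [set y in Y | _].
rewrite -cardsT -cardsX.
pose f (p : F * 'rV[F]_n) := p.2 + p.1 *: u.
rewrite -sum1_card (partition_big f (mem Y)) /=; last first.
  by case=> t y; rewrite !inE /= => /andP[yY _]; apply: Ycl.
rewrite mulnC -sum_nat_const; apply: leq_sum => y yY.
rewrite sum1dep_card.
have yu : (dot u u != 0) || (- 2%:R * dot y u != 0).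
  by have := Yu y yY; rewrite mulf_eq0 oppr_eq0 (negPf F2).
apply: leq_trans (card_quadratic_roots (dot y y - c) yu).
rewrite -(card_in_imset (f := fst)); last first.
  move=> [s v] [t w]; rewrite !inE /= => /andP[_ /eqP Ev] /andP[_ /eqP Ew] st.
  by move: Ev Ew; rewrite /f /= st => <- /addIr ->.
apply/subset_leq_card/subsetP => _ /imsetP[[t v] tv ->].
move: tv; rewrite !inE /f /= => /andP[/andP[_ /eqP vc] /eqP <-].
apply/eqP; rewrite -vc !(dotDl, dotDr, dotZl, dotZr) (dotC u v); ring.
Qed.

(** * Few orthogonal matrices map one given vector to another *)

Definition pointwise_stab k n (W : 'M[F]_(k, n)) : {set 'M[F]_n} :=
  [set g in Ogroup F n | W *m g == W].

(** A nonempty fiber of an orbit map is a coset of the stabiliser; the subgroup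
    [S] of [Ogroup F n] is given as a plain set stable under
    [g h^-1 = g h^T]. *)
Lemma card_orbit_fiber k n (W : 'M[F]_(k, n)) (S : {set 'M[F]_n})
    (v : 'M[F]_(k, n)) :
    S \subset Ogroup F n -> {in S &, forall g h, g *m h^T \in S} ->
  (#|[set g in S | W *m g == v]| <= #|[set g in S | W *m g == W]|)%N.
Proof.
move=> /subsetP SO Sdiv; set X := [set g in S | W *m g == v].
have [->|[g0 g0X]] := set_0Vmem X; first by rewrite cards0.
have /OgroupP g0g0T : g0 \in Ogroup F n.
  by move: g0X; rewrite inE => /andP[/SO].
rewrite -(card_in_imset (f := fun g => g *m g0^T) (D := X)); last first.
  move=> g h _ _ /(congr1 (mulmx^~ g0)).
  by rewrite -!mulmxA (mulmx1C g0g0T) !mulmx1.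
apply/subset_leq_card/subsetP => _ /imsetP[g gX ->].
move: gX g0X; rewrite /X !inE => /andP[gS /eqP gv] /andP[g0S /eqP g0v].
by rewrite Sdiv //= mulmxA gv -g0v -mulmxA g0g0T mulmx1.
Qed.

(** The set contains the orbit of [w] under the pointwise stabiliser of [W].
    The linear conditions alone define a coset [Y] of [U], the orthogonal of the
    rows of [W].  [card_quadric_lines] needs a direction [u] in [U] along
    which [dot v v] is nonconstant on [Y]: an anisotropic [u] will do, and if
    [U] is totally isotropic then any [u] in [U] with [dot w u != 0], which
    exists because [w] is outside the row space of [W], that is, outside the
    orthogonal of [U]. *)
Lemma card_metric_translates k n (W : 'M[F]_(k, n)) (w : 'rV_n) :
    row_free (col_mx W w) ->
  (#|F| * #|[set v : 'rV_n | (v *m W^T == w *m W^T) && (dot v v == dot w w)]|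
     <= 2 * #|F| ^ (n - k))%N.
Proof.
move=> Ww_free; have Wfree : row_free W.
  move: Ww_free; rewrite -!kermx_eq0 => /eqP K0; apply/eqP.
  apply/eqP; rewrite -submx0; apply/rV_subP => x /sub_kermxP xW.
  have: row_mx x 0 *m col_mx W w = 0 by rewrite mul_row_col xW mul0mx addr0.
  move/sub_kermxP; rewrite K0 submx0 row_mx_eq0 => /andP[/eqP-> _].
  exact: sub0mx.
have wW : ~~ (w <= W)%MS.
  apply/negP => /submxP[D wD]; move: Ww_free; rewrite -kermx_eq0 => /eqP K0.
  have: row_mx D (- 1%:M) *m col_mx W w = 0.
    by rewrite mul_row_col mulNmx mul1mx wD subrr.
  move/sub_kermxP; rewrite K0 submx0 row_mx_eq0 => /andP[_ /eqP].
  by move=> /matrixP/(_ 0 0)/eqP; rewrite !mxE eqxx oppr_eq0 oner_eq0.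
pose U := [set u : 'rV_n | u *m W^T == 0].
pose Y := [set v : 'rV_n | v *m W^T == w *m W^T].
have cY : #|Y| = (#|F| ^ (n - k))%N.
  rewrite -(eqP Wfree) -mxrank_tr -card_left_annihilator.
  rewrite -/U -(card_imset U (addrI w)); congr #|pred_of_set _|.
  apply/setP => y; apply/idP/imsetP.
    rewrite inE => /eqP yw; exists (y - w); last by rewrite addrC subrK.
    by rewrite inE mulmxBl yw subrr.
  by case=> u; rewrite !inE => /eqP u0 ->; rewrite mulmxDl u0 addr0.
have [u uU uY] : exists2 u, u \in U &
    forall y, y \in Y -> (dot u u != 0) || (dot y u != 0).
  have [iso|] := boolP [forall u in U, dot u u == 0]; last first.
    rewrite negb_forall => /existsP[u]; rewrite negb_imply => /andP[uU uu].
    by exists u => // y _; rewrite uu.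
  have {}iso x : x \in U -> dot x x = 0 by move/(forall_inP iso)/eqP.
  have polar x y : x \in U -> y \in U -> dot x y = 0.
    move=> xU yU; have xyU : x + y \in U.
      by move: xU yU; rewrite !inE mulmxDl => /eqP-> /eqP->; rewrite addr0.
    have := iso _ xyU; rewrite !(dotDl, dotDr) !iso // (dotC y x) add0r addr0.
    by move=> h; apply: (mulfI F2); rewrite mulr0 -h; ring.
  have : w *m cokermx W != 0 by rewrite -submxE.
  case/matrix0Pn => i [j wj].
  (* The columns of [cokermx W] span [U]. *)
  pose u := (col j (cokermx W))^T.
  have uU : u \in U.
    by rewrite inE /u -trmx_mul colE mulmxA mulmx_coker mul0mx trmx0.
  exists u => // y yY; apply/orP; right.
  have ywU : y - w \in U.
    by move: yY; rewrite !inE mulmxBl => /eqP->; rewrite subrr.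
  rewrite -(subrK w y) dotDl polar // add0r.
  by rewrite /dot /u trmxK colE mulmxA -colE mxE -(ord1 i).
have Ycl y t : y \in Y -> y + t *: u \in Y.
  move: uU; rewrite !inE => /eqP u0 /eqP yw.
  by rewrite mulmxDl -scalemxAl u0 scaler0 addr0 yw.
rewrite -cY (_ : [set v | _ & _] = [set y in Y | dot y y == dot w w]).
  exact: card_quadric_lines Ycl uY.
by apply/setP => v; rewrite !inE.
Qed.

(** Extending [W] by one more independent row [w], orbit-stabiliser and
    [card_metric_translates] cost a factor [2 * q ^ i], where [i] is the
    number of rows still missing afterwards; as [i] runs down from [j - 1] to
    [0], these exponents add up to ['C(j, 2)]. *)
Lemma card_pointwise_stab n j k (W : 'M[F]_(k, n)) :
  row_free W -> (k + j = n)%N ->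
  (#|pointwise_stab W| <= 2 ^ j * #|F| ^ 'C(j, 2))%N.
Proof.
elim: j k W => [|j IHj] k W Wfree kj.
  rewrite bin0n muln1 expn0.
  have Wfull : row_full W.
    by rewrite /row_full (eqP Wfree) -kj addn0.
  rewrite -(cards1 (1%:M : 'M[F]_n)); apply/subset_leq_card/subsetP => g.
  rewrite !inE => /andP[_ /eqP Wg]; apply/eqP.
  have [V VW] := row_fullP Wfull.
  by rewrite -[g]mul1mx -VW -mulmxA Wg.
have [w Ww_free] : exists w : 'rV_n, row_free (col_mx W w).
  have : ~~ (1%:M <= W)%MS.
    by rewrite sub1mx /row_full (eqP Wfree) -kj -[X in X == _]addn0 eqn_add2l.
  case/row_subPn => i; set w := row i _ => wW; exists w.
  rewrite -kermx_eq0 -submx0; apply/rV_subP => x /sub_kermxP.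
  rewrite -[x]hsubmxK mul_row_col => h.
  have r0 : rsubmx x = 0.
    apply: contraNeq wW => /matrix0Pn[a [b]]; rewrite !ord1 => r0.
    have rw : rsubmx x *m w = rsubmx x 0 0 *: w.
      by rewrite [in LHS](mx11_scalar (rsubmx x)) mul_scalar_mx.
    move/eqP: h; rewrite rw addrC addr_eq0 => /eqP.
    move/(congr1 ( *:%R (rsubmx x 0 0)^-1)).
    rewrite scalerA mulVf // scale1r => ->.
    by rewrite scalerN -scaleNr scalemx_sub // submxMl.
  move: h; rewrite r0 mul0mx addr0 => /sub_kermxP.
  move: Wfree; rewrite -kermx_eq0 => /eqP->; rewrite submx0 => /eqP->.
  by rewrite row_mx0 sub0mx.
have q0 : (0 < #|F|)%N by apply/card_gt0P; exists 0.
have {IHj} IH : (#|pointwise_stab (col_mx W w)| <= 2 ^ j * #|F| ^ 'C(j, 2))%N.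
  by apply: IHj => //; rewrite addn1 addSnnS.
pose X := [set v : 'rV_n | (v *m W^T == w *m W^T) && (dot v v == dot w w)].
have cX : (#|X| <= 2 * #|F| ^ j)%N.
  rewrite -(leq_pmul2l q0) mulnCA -expnS.
  have -> : j.+1 = (n - k)%N by rewrite -kj addKn.
  exact: card_metric_translates.
have step : (#|pointwise_stab W| <= #|X| * #|pointwise_stab (col_mx W w)|)%N.
  rewrite -sum1_card (partition_big (fun g => w *m g) (mem X)) /=; last first.
    move=> g; rewrite inE => /andP[/OgroupP gO /eqP Wg]; rewrite inE /dot.
    have gK i (x : 'M_(i, n)) : x *m g *m g^T = x by rewrite -mulmxA gO mulmx1.
    by rewrite -{1}Wg !trmx_mul !mulmxA !gK !eqxx.
  rewrite -sum_nat_const; apply: leq_sum => v _; rewrite sum1dep_card.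
  apply: leq_trans (card_orbit_fiber w v _ _) _.
  - by apply/subsetP => g; rewrite inE => /andP[].
  - move=> g h; rewrite !(in_set (fun _ => _ && _)).
    move=> /andP[gO /eqP Wg] /andP[hO /eqP Wh].
    rewrite OgroupM ?OgroupT //= mulmxA Wg -{1}Wh -mulmxA.
    by rewrite (OgroupP _ hO) mulmx1.
  apply/subset_leq_card/subsetP => g; rewrite !inE mul_col_mx.
  by move=> /andP[/andP[-> /eqP->] /eqP->]; rewrite eqxx.
apply: leq_trans step _; apply: leq_trans (leq_mul cX IH) _.
by rewrite binS bin1 expnD expnS mulnACA [(#|F| ^ j * _)%N]mulnC.
Qed.

Lemma card_Ogroup_sending n (xi eta : 'rV[F]_n) : xi != 0 ->
  (#|[set g in Ogroup F n | xi *m g == eta]|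
     <= 2 ^ n.-1 * #|F| ^ 'C(n.-1, 2))%N.
Proof.
move=> xi0; apply: leq_trans (card_orbit_fiber xi eta (subxx _) _) _.
  by move=> g h gO hO; rewrite OgroupM ?OgroupT.
have n0 : (0 < n)%N.
  by case: n xi {eta} xi0 => // xi; rewrite thinmx0 eqxx.
apply: card_pointwise_stab; last by rewrite add1n prednK.
by rewrite /row_free rank_rV xi0.
Qed.

(** * A lower bound for the order of the orthogonal group *)

Definition refl_mx n (y : 'rV[F]_n) : 'M[F]_n :=
  1%:M - (2%:R / dot y y) *: (y^T *m y).

Lemma mul_refl_mx n (y x : 'rV_n) :
  x *m refl_mx y = x - (2%:R * dot x y / dot y y) *: y.
Proof.
rewrite /refl_mx mulmxBr mulmx1 -scalemxAr mulmxA (mx11_scalar (x *m y^T)).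
by rewrite mul_scalar_mx scalerA -/(dot x y) mulrAC.
Qed.

Lemma refl_mx_Ogroup n (y : 'rV_n) : dot y y != 0 -> refl_mx y \in Ogroup F n.
Proof.
move=> y0; apply/OgroupP.
have -> : (refl_mx y)^T = refl_mx y.
  by rewrite /refl_mx linearB linearZ /= trmx1 trmx_mul trmxK.
apply/row_matrixP => i; rewrite !rowE mulmxA mulmx1 !mul_refl_mx.
rewrite dotDl -!scaleNr dotZl -addrA -scalerDl.
set c := (X in _ + X *: y); have -> : c = 0 by rewrite /c; field.
by rewrite scale0r addr0.
Qed.

Lemma block_diag_Ogroup n (h : 'M_n) :
  h \in Ogroup F n -> block_mx 1%:M 0 0 h \in Ogroup F (1 + n).
Proof.
move=> /OgroupP hO; apply/OgroupP.
rewrite tr_block_mx mulmx_block !trmx0 trmx1 hO.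
by rewrite !mulmx0 !mul0mx mulmx1 !addr0 add0r -scalar_mx_block.
Qed.

Lemma dot_row_mx n (x : 'rV_n) :
  dot (row_mx 1%:M x) (row_mx 1%:M x) = 1 + dot x x.
Proof. by rewrite /dot tr_row_mx mul_row_col trmx1 mulmx1 !mxE eqxx. Qed.

Lemma card_sphere_ub n c :
  (#|F| * #|[set x : 'rV[F]_n.+1 | dot x x == c]| <= 2 * #|F| ^ n.+1)%N.
Proof.
have -> : (#|F| ^ n.+1 = #|[set: 'rV[F]_n.+1]|)%N.
  by rewrite cardsT card_mx mul1n.
rewrite (_ : [set x | _] = [set x in setT | dot x x == c]); last first.
  by apply/setP => x; rewrite !inE.
apply: (@card_quadric_lines _ _ (delta_mx 0 0)) => y.
  by move=> *; rewrite !inE.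
move=> _.
by rewrite /dot trmx_delta mul_delta_mx mxE !eqxx oner_eq0.
Qed.

(** The condition [dot x x != -1] says that the vector [(1, x)] is anisotropic.
    For [n > 0], by [card_sphere_ub] it holds for a proportion at least
    [1 - 2 / q] of all [x], and [q >= 3]. *)
Lemma card_nonisotropic_lb n : odd #|F| ->
  (#|F| ^ n <= 3 * #|[set x : 'rV[F]_n | (dot x x != -1)%R]|)%N.
Proof.
move=> oddF; case: n => [|n].
  rewrite expn0 muln_gt0; apply/card_gt0P; exists 0.
  by rewrite inE /dot mul0mx mxE eq_sym oppr_eq0 oner_eq0.
have q1 : (1 < #|F|)%N := card_finNzRing_gt1 F.
have q3 : (3 <= #|F|)%N by move: q1 oddF; case: #|F| => [|[|[|]]].
have := card_sphere_ub n (-1); set Z := [set x | _] => cZ.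
have -> : [set x : 'rV[F]_n.+1 | (dot x x != -1)%R] = ~: Z.
  by apply/setP => x; rewrite !inE.
have := cardsC Z; rewrite card_mx mul1n.
move: cZ; move: (#|~: Z|) (#|Z|) (#|F| ^ n.+1)%N => a z Q h1 h2.
nia.
Qed.

(** Send [(x, h)] to [1 (+) h] followed by the reflection in [y = (1, x)].  This
    moves the first basis vector [e] to [e] minus a nonzero multiple of [y], and
    the first coordinate of [y] is [1]; hence the product determines [y], and
    then [h]. *)
Lemma card_Ogroup_step n :
  (#|[set x : 'rV[F]_n | (dot x x != -1)%R]| * #|Ogroup F n|
     <= #|Ogroup F n.+1|)%N.
Proof.
rewrite -cardsX.
pose y (x : 'rV[F]_n) : 'rV[F]_(1 + n) := row_mx 1%:M x.
pose f (p : 'rV[F]_n * 'M[F]_n) : 'M[F]_(1 + n) :=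
  block_mx 1%:M 0 0 p.2 *m refl_mx (y p.1).
have y0 (x : 'rV_n) : dot x x != -1 -> dot (y x) (y x) != 0.
  by rewrite dot_row_mx addrC addr_eq0.
rewrite -(card_in_imset (f := f)).
  apply/subset_leq_card/subsetP => _ /imsetP[[x h] /setXP[/= + hO] ->].
  rewrite inE => /y0 yx.
  by apply: OgroupM; [exact: block_diag_Ogroup | exact: refl_mx_Ogroup].
move=> [x h] [x' h'] /setXP[/= + _] /setXP[/= + _].
rewrite !inE => /y0 yx /y0 yx'; rewrite /f /= => E.
pose e : 'rV[F]_(1 + n) := row_mx 1%:M 0.
have eE (k : 'M_n) (z : 'rV_n) : dot (y z) (y z) != 0 ->
    e *m (block_mx 1%:M 0 0 k *m refl_mx (y z))
      = e - (2%:R / dot (y z) (y z)) *: y z.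
  move=> z0; rewrite mulmxA mul_row_block !(mul1mx, mul0mx) !addr0 mul_refl_mx.
  rewrite [dot (row_mx _ _) _]/dot tr_row_mx mul_row_col trmx1 mul0mx addr0.
  by rewrite mulmx1 mxE eqxx mulr1.
have := congr1 (mulmx e) E; rewrite !eE // => /addrI/oppr_inj Exx'.
have xx' : x = x'.
  move: Exx'; rewrite !scale_row_mx => /eq_row_mx[].
  move=> /matrixP/(_ 0 0); rewrite !mxE eqxx !mulr1 => -> /scalerI; apply.
  by rewrite mulf_neq0 ?invr_eq0.
congr (_, _) => //; move: E; rewrite xx'.
move/(congr1 (mulmx^~ (refl_mx (y x'))^T)).
rewrite -!mulmxA (OgroupP _ (refl_mx_Ogroup yx')) !mulmx1.
by case/eq_block_mx.
Qed.

Lemma card_Ogroup_lb n : odd #|F| ->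
  (#|F| ^ 'C(n, 2) <= 3 ^ n * #|Ogroup F n|)%N.
Proof.
move=> oddF; elim: n => [|n IHn].
  rewrite expn0 mul1n; apply/card_gt0P; exists 1%:M.
  by apply/OgroupP; rewrite trmx1 mulmx1.
rewrite binS bin1 expnD mulnC.
apply: leq_trans (leq_mul (card_nonisotropic_lb n oddF) IHn) _.
by rewrite mulnACA -expnS leq_mul2l card_Ogroup_step orbT.
Qed.

Lemma card_Ogroup_sending_le n (xi eta : 'rV[F]_n) : odd #|F| -> xi != 0 ->
  (#|[set g in Ogroup F n | xi *m g == eta]|
     <= 6 ^ n.-1 * #|Ogroup F n.-1|)%N.
Proof.
move=> oddF xi0; apply: leq_trans (card_Ogroup_sending eta xi0) _.
by rewrite (expnMn 2 3) -mulnA leq_mul2l card_Ogroup_lb // orbT.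
Qed.

End LinearAlgebra.

(** * Sums of a function over the fibers of linear maps *)

Section Radon.
Variables (R : realFieldType) (F : finFieldType).
Local Notation q := (#|F|%:R : R).

(** For [k = 1] and [xi != 0] the values of [push xi u] are the sums of [u] over
    the affine hyperplanes parallel to the kernel of [xi]: a finite Radon
    transform. *)
Definition push k n (M : 'M[F]_(k, n)) (u : 'cV[F]_n -> R) (z : 'cV[F]_k) : R :=
  \sum_(x | M *m x == z) u x.

Definition energy k n (M : 'M[F]_(k, n)) (u : 'cV[F]_n -> R) : R :=
  \sum_z push M u z ^+ 2.

Lemma energy_ge0 k n (M : 'M_(k, n)) u : 0 <= energy M u.
Proof. by apply: sumr_ge0 => z _; apply: sqr_ge0. Qed.

Lemma sum_push k n (M : 'M_(k, n)) u : \sum_z push M u z = \sum_x u x.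
Proof. by rewrite (partition_big (mulmx M) predT). Qed.

Lemma push_comp l k n (N : 'M_(l, k)) (M : 'M_(k, n)) u :
  push N (push M u) =1 push (N *m M) u.
Proof.
move=> w; rewrite /push [RHS](partition_big (mulmx M) (fun z => N *m z == w)).
  apply: eq_bigr => z /eqP Nz; apply: eq_bigl => x.
  by rewrite -mulmxA andbC; case: eqP => // ->; rewrite Nz eqxx.
by move=> x; rewrite mulmxA.
Qed.

Lemma energy_comp l k n (N : 'M_(l, k)) (M : 'M_(k, n)) u :
  energy N (push M u) = energy (N *m M) u.
Proof. by apply: eq_bigr => z _; rewrite push_comp. Qed.

Lemma energyE k n (M : 'M_(k, n)) u :
  energy M u = \sum_x \sum_y (M *m (x - y) == 0)%:R * (u x * u y).
Proof.
rewrite [RHS](partition_big (mulmx M) predT) //; apply: eq_bigr => z _.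
rewrite expr2 /push mulr_suml; apply: eq_bigr => x /eqP Mx.
rewrite mulr_sumr big_mkcond; apply: eq_bigr => y _.
by rewrite mulmxBr Mx subr_eq0 eq_sym; case: eqP; rewrite ?mul1r ?mul0r.
Qed.

Lemma energy0 k n (u : 'cV_n -> R) :
  \sum_x u x = 0 -> energy (0 : 'M_(k, n)) u = 0.
Proof.
move=> u0; rewrite energyE big1 // => x _.
under eq_bigr do rewrite mul0mx eqxx mul1r.
by rewrite -mulr_sumr u0 mulr0.
Qed.

(** Expanding the squares by [energyE], the product [u x * u y] occurs once for
    every [xi] that vanishes at [x - y]: [q ^ n] times if [x = y] and
    [q ^ (n - 1)] times otherwise.  As [u] has mean zero, only the excess on the
    diagonal survives. *)
Lemma sum_energy n (u : 'cV_n -> R) : \sum_x u x = 0 ->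
  \sum_(xi : 'rV_n) energy xi u = (q ^+ n - q ^+ n.-1) * \sum_x u x ^+ 2.
Proof.
move=> u0; under eq_bigr do rewrite energyE.
rewrite exchange_big mulr_sumr; apply: eq_bigr => x _ /=.
rewrite exchange_big /=.
have cnt y : \sum_(xi : 'rV_n) (xi *m (x - y) == 0)%:R * (u x * u y)
    = q ^+ n.-1 * u x * u y + (y == x)%:R * ((q ^+ n - q ^+ n.-1) * u x * u y).
  rewrite -mulr_suml -natr_sum -big_mkcond sum1dep_card.
  rewrite card_left_annihilator_cV subr_eq0 (eq_sym x).
  rewrite (fun_if (fun k : nat => k%:R : R)) !natrX.
  move: (q ^+ n) (q ^+ n.-1) => s t.
  by case: eqP => _; rewrite ?mul1r ?mul0r; ring.
rewrite (eq_bigr _ (fun y _ => cnt y)) big_split /= -mulr_sumr u0 mulr0 add0r.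
rewrite (bigD1 x) //= eqxx big1 => [|y /negPf->]; last by rewrite mul0r.
by rewrite addr0 mul1r expr2 mulrA.
Qed.

Definition discrepancy n (S : {set 'cV[F]_n}) (x : 'cV[F]_n) : R :=
  (x \in S)%:R - #|S|%:R / q ^+ n.

Lemma q_gt0 : 0 < q.
Proof. by rewrite ltr0n; apply/card_gt0P; exists 0. Qed.

Lemma sum_indicator (T : finType) (S : {set T}) :
  \sum_x (x \in S)%:R = #|S|%:R :> R.
Proof. by rewrite -natr_sum -big_mkcond sum1_card. Qed.

Lemma sum_discrepancy n (S : {set 'cV_n}) : \sum_x discrepancy S x = 0.
Proof.
rewrite sumrB sum_indicator sumr_const card_mx muln1.
rewrite -[X in _ - X]mulr_natr natrX.
by rewrite divfK ?subrr // expf_neq0 // gt_eqF ?q_gt0.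
Qed.

Lemma sum_discrepancy_sq n (S : {set 'cV_n}) :
  \sum_x discrepancy S x ^+ 2 <= #|S|%:R.
Proof.
set m := #|S|%:R / q ^+ n.
have -> : \sum_x discrepancy S x ^+ 2
    = \sum_x (x \in S)%:R - m * \sum_x (x \in S)%:R
        - m * \sum_x discrepancy S x.
  rewrite !mulr_sumr -!sumrB; apply: eq_bigr => x _; rewrite /discrepancy -/m.
  by case: (x \in S) => /=; ring.
rewrite sum_discrepancy mulr0 subr0 sum_indicator gerBl.
by rewrite !mulr_ge0 ?invr_ge0 ?exprn_ge0 ?ler0n.
Qed.

End Radon.

(** * The variance of the intersection numbers, averaged over rotations *)

Section Rotations.
Variables (R : realFieldType) (F : finFieldType) (d : nat).
Hypothesis oddF : odd #|F|.
Local Notation q := (#|F|%:R : R).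

Definition prodset (A B : {set 'cV[F]_d}) : {set 'cV[F]_(d + d)} :=
  [set x | (usubmx x \in A) && (dsubmx x \in B)].

Lemma card_prodset A B : #|prodset A B| = (#|A| * #|B|)%N.
Proof.
rewrite -cardsX -(card_imset (finset.setX A B) (f := fun p => col_mx p.1 p.2)).
  congr #|pred_of_set _|; apply/setP => x; rewrite inE; apply/andP/imsetP.
    move=> [xA xB]; exists (usubmx x, dsubmx x); last by rewrite vsubmxK.
    by rewrite inE /= xA xB.
  by case=> -[a b] /setXP[/= aA bB] ->; rewrite col_mxKu col_mxKd.
by move=> [a b] [a' b'] /= /eq_col_mx[-> ->].
Qed.

Definition diff_mx (g : 'M[F]_d) : 'M[F]_(d, d + d) := row_mx 1%:M (- g).

Lemma mul_diff_mx g (x : 'cV_(d + d)) :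
  diff_mx g *m x = usubmx x - g *m dsubmx x.
Proof. by rewrite -{1}[x]vsubmxK mul_row_col mul1mx mulNmx. Qed.

Lemma card_rotated_cap g A B z : g \in Ogroup F d ->
  #|A :&: moved g B z| = #|[set x in prodset A B | diff_mx g *m x == z]|.
Proof.
move=> /(OgroupP (odd_card_natr2 oddF)) gO; have gTg := mulmx1C gO.
rewrite -(card_in_imset (f := usubmx) (D := [set x in prodset A B | _])).
  congr #|pred_of_set _|; apply/setP => a; rewrite inE; apply/andP/imsetP.
    move=> [aA /imsetP[b bB abz]].
    exists (col_mx a b); last by rewrite col_mxKu.
    by rewrite !inE mul_diff_mx col_mxKu col_mxKd aA bB abz addrC addKr eqxx.
  case=> x; rewrite !inE mul_diff_mx => /andP[/andP[xA xB] /eqP xz] ->.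
  split=> //; apply/imsetP; exists (dsubmx x) => //.
  by rewrite -xz addrC subrK.
move=> x y; rewrite !inE !mul_diff_mx => /andP[_ /eqP <-] /andP[_ /eqP xy] uxy.
rewrite -[x]vsubmxK -[y]vsubmxK uxy; congr col_mx.
move: xy; rewrite uxy => /addrI/oppr_inj/(congr1 (mulmx g^T)).
by rewrite !mulmxA gTg !mul1mx.
Qed.

(** Every fiber of the surjection [diff_mx g] has [q ^ d] points, so subtracting
    the density of [A * B] upstairs subtracts the mean of the intersection
    numbers downstairs. *)
Lemma push_discrepancy g A B z : g \in Ogroup F d ->
  push (diff_mx g) (discrepancy R (prodset A B)) z
    = #|A :&: moved g B z|%:R - #|A|%:R * #|B|%:R / q ^+ d.
Proof.
move=> gO; rewrite /push sumrB; congr (_ - _).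
  rewrite card_rotated_cap // -sum_indicator big_mkcond.
  by apply: eq_bigr => x _; rewrite [in RHS]in_set [in RHS]andbC; case: eqP.
rewrite sumr_const card_prodset natrM.
have -> : #|[pred x | diff_mx g *m x == z]| = (#|F| ^ d)%N.
  have -> : (#|F| ^ d = #|[set: 'cV[F]_d]|)%N by rewrite cardsT card_mx muln1.
  rewrite -(card_imset [set: 'cV[F]_d] (f := fun b => col_mx (z + g *m b) b)).
    apply: eq_card => x; rewrite inE mul_diff_mx; apply/eqP/imsetP.
      by move=> <-; exists (dsubmx x); rewrite ?inE // subrK vsubmxK.
    by case=> b _ ->; rewrite col_mxKu col_mxKd addrK.
  by move=> b c /eq_col_mx[].
have q0 := gt_eqF (q_gt0 R F).
by rewrite -[LHS]mulr_natr natrX exprD; field; rewrite ?expf_eq0 ?q0 ?andbF.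
Qed.

Lemma big_row_mx (f : 'rV[F]_(d + d) -> R) :
  \sum_zeta f zeta = \sum_xi \sum_eta f (row_mx xi eta).
Proof.
rewrite pair_big /=.
apply: (reindex (fun p : 'rV[F]_d * 'rV[F]_d => row_mx p.1 p.2)).
exists (fun zeta => (lsubmx zeta, rsubmx zeta)) => [[a b]|zeta] _ /=.
  by rewrite row_mxKl row_mxKr.
by rewrite hsubmxK.
Qed.

Local Notation K := ((6 ^ d.-1 * #|Ogroup F d.-1|)%:R : R).

(** For [xi != 0], each [eta] is of the form [- xi *m g] for at most [K]
    rotations [g]; at [xi = 0] no such bound holds, but there the left-hand side
    vanishes because [u] has mean zero. *)
Lemma sum_rotated_direction (u : 'cV_(d + d) -> R) (xi : 'rV_d) :
    \sum_x u x = 0 ->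
  \sum_(g in Ogroup F d) energy (xi *m diff_mx g) u
    <= K * \sum_eta energy (row_mx xi eta) u.
Proof.
move=> u0; have [->|xi0] := eqVneq xi 0.
  rewrite big1 => [|g _]; last by rewrite mul0mx energy0.
  by rewrite mulr_ge0 // ?ler0n // sumr_ge0 // => eta _; apply: energy_ge0.
rewrite (partition_big (fun g => - (xi *m g)) predT) //= mulr_sumr.
apply: ler_sum => eta _.
rewrite (eq_bigr (fun=> energy (row_mx xi eta) u)); last first.
  by move=> g /andP[_ /eqP <-]; rewrite mul_mx_row mulmx1 mulmxN.
rewrite sumr_const -[X in X <= _]mulr_natl ler_wpM2r ?energy_ge0 // ler_nat.
have F2 := odd_card_natr2 oddF.
apply: leq_trans (card_Ogroup_sending_le F2 (- eta) oddF xi0).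
apply/eq_leq/eq_card => g; rewrite [in RHS]inE -topredE /=.
by rewrite eqr_oppLR.
Qed.

(** Both sides are multiplied by the constant of [sum_energy] in dimension [d],
    which turns each energy into a sum over the directions [xi]. *)
Lemma sum_rotated_variance (A B : {set 'cV[F]_d}) : (0 < d)%N ->
  \sum_(g in Ogroup F d) energy (diff_mx g) (discrepancy R (prodset A B))
    <= K * q ^+ d * (#|A|%:R * #|B|%:R).
Proof.
move=> d0; set u := discrepancy R (prodset A B).
have u0 : \sum_x u x = 0 := sum_discrepancy R (prodset A B).
have q1 : 1 < q by rewrite ltr1n card_finNzRing_gt1.
have qq : 0 < q ^+ d - q ^+ d.-1.
  by rewrite subr_gt0 ltr_eXn2l // prednK.
rewrite -(ler_pM2l qq).
have -> : (q ^+ d - q ^+ d.-1) * (\sum_(g in Ogroup F d) energy (diff_mx g) u)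
    = \sum_(xi : 'rV_d) \sum_(g in Ogroup F d) energy (xi *m diff_mx g) u.
  rewrite [RHS]exchange_big mulr_sumr; apply: eq_bigr => g _ /=.
  rewrite [energy _ _]/energy -(@sum_energy _ _ _ (push (diff_mx g) u)) //;
    last by rewrite sum_push.
  by apply: eq_bigr => xi _; rewrite energy_comp.
apply: le_trans (ler_sum _ (fun xi _ => sum_rotated_direction xi u0)) _.
rewrite -mulr_sumr -(big_row_mx (fun zeta => energy zeta u)) sum_energy //.
have -> : (q ^+ d - q ^+ d.-1) * (K * q ^+ d * (#|A|%:R * #|B|%:R))
   = K * ((q ^+ (d + d) - q ^+ (d + d).-1) * #|prodset A B|%:R).
  have -> : (d + d).-1 = (d.-1 + d)%N by lia.
  by rewrite card_prodset natrM !exprD; ring.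
rewrite ler_wpM2l ?ler0n // ler_wpM2l ?sum_discrepancy_sq //.
by rewrite subr_ge0 ler_weXn2l ?ltW // leq_pred.
Qed.

End Rotations.

(** * The exceptional rotations *)

Lemma markov_card (R : realFieldType) (T : finType) (D : {set T})
    (f : T -> R) (c : R) :
    (forall x, 0 <= f x) ->
  c * #|[set x in D | c < f x]|%:R <= \sum_(x in D) f x.
Proof.
move=> f0; rewrite -sum1_card natr_sum mulr_sumr.
rewrite [X in _ <= X](bigID (fun x => c < f x)) /= -[X in X <= _]addr0 lerD //.
  rewrite (eq_bigl (fun x => (x \in D) && (c < f x))); last first.
    by move=> x; rewrite inE.
  by apply: ler_sum => x /andP[_ /ltW]; rewrite mulr1.
by apply: sumr_ge0.
Qed.

Theorem theorem4p1 (R : realType) (d : nat) (hd : (2 <= d)%N) :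
  exists C1 C2 C3 C4 : R,
    [/\ 0 < C1, 0 < C2, 0 < C3 & 0 < C4] /\
    forall (F : finFieldType) (A B : {set 'cV[F]_d}),
      odd #|F| ->
      exists E : {set 'M[F]_d},
        [/\ E \subset Ogroup F d,
            lesssim C1 #|E|%:R
              (#|Ogroup F d.-1|%:R * #|F|%:R ^+ (2 * d)
                / (#|A|%:R * #|B|%:R))
          & forall g : 'M[F]_d, g \in Ogroup F d :\: E ->
              lesssim C2 (#|F|%:R ^+ d)
                #|[set z : 'cV[F]_d |
                    simeq C3 C4 #|A :&: moved g B z|%:R
                      (#|A|%:R * #|B|%:R / #|F|%:R ^+ d)]|%:R].
Proof.
exists (8%:R * 6%:R ^+ d.-1), 2%:R, (3%:R / 2%:R), 2%:R; split.
  by split; rewrite ?mulr_gt0 ?exprn_gt0 ?invr_gt0 ?ltr0n.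
move=> F A B oddF; rewrite /lesssim.
set N : R := #|A|%:R * #|B|%:R; set q : R := #|F|%:R.
have q0 : 0 < q := q_gt0 R F.
have qd0 : 0 < q ^+ d by rewrite exprn_gt0.
(* If [A] or [B] is empty, the required bound on [#|E|] is [0], as division by
   zero gives [0]; and [E = set0] will do since every intersection is empty. *)
have [N0|N0] := eqVneq N 0.
  exists set0; split; first exact: sub0set.
    by rewrite cards0 N0 invr0 !mulr0.
  move=> g _; rewrite [X in #|pred_of_set X|](_ : _ = setT); last first.
    apply/setP => z; rewrite !inE N0 mul0r /simeq /lesssim mulr0.
    rewrite lern0 mulr_ge0 ?ler0n // andbT cards_eq0 -subset0.
    move/eqP: N0; rewrite /N -natrM pnatr_eq0 muln_eq0 !cards_eq0.
    case/orP=> /eqP->; first by rewrite set0I subxx.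
    by rewrite /moved imset0 setI0 subxx.
  rewrite cardsT card_mx muln1 natrX -/q; lra.
have Ngt0 : 0 < N by rewrite lt_def N0 /N mulr_ge0 ?ler0n.
pose V g := energy (diff_mx g) (discrepancy R (prodset A B)).
have V0 g : 0 <= V g by apply: energy_ge0.
(* [c = M ^ 2 q ^ d / 8]: with the threshold [M ^ 2 / 4] for a single [z] this
   leaves at most [q ^ d / 2] bad values of [z]. *)
pose c := N ^+ 2 / (8%:R * q ^+ d).
have c0 : 0 < c.
  by apply: divr_gt0; [exact: exprn_gt0 | rewrite mulr_gt0 ?ltr0n].
pose E := [set g in Ogroup F d | c < V g].
exists E; split; first by apply/subsetP => g; rewrite inE => /andP[].
  have := le_trans (markov_card (Ogroup F d) c V0)
    (sum_rotated_variance R oddF A B (ltnW hd)).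
  rewrite -/E -/N -/q natrM natrX mulrC -ler_pdivlMr // => /le_trans; apply.
  rewrite le_eqVlt; apply/orP; left; apply/eqP.
  rewrite /c mul2n -addnn exprD; field.
  by rewrite N0 (gt_eqF qd0).
move=> g; rewrite in_setD => /andP[gE gO].
have Vc : V g <= c by move: gE; rewrite /E inE gO /= -leNgt.
set M := N / q ^+ d; have M0 : 0 < M by rewrite divr_gt0.
set G := [set z | _].
pose w z : R := (#|A :&: moved g B z|%:R - M) ^+ 2.
have Vw : V g = \sum_(z in setT) w z.
  by apply: eq_big => [z | z _]; rewrite ?inE ?push_discrepancy.
pose bad := [set z in setT | M ^+ 2 / 4%:R < w z].
have cbad : M ^+ 2 / 4%:R * #|bad|%:R <= c.
  apply: le_trans Vc; rewrite Vw; apply: markov_card => z; exact: sqr_ge0.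
have {}cbad : 2%:R * #|bad|%:R <= q ^+ d.
  rewrite -(ler_pM2l (_ : 0 < M ^+ 2 / 8%:R)) ?divr_gt0 ?exprn_gt0 //.
  have -> : M ^+ 2 / 8%:R * q ^+ d = c.
    by rewrite /c /M; field; rewrite (gt_eqF qd0).
  by apply: le_trans cbad; rewrite le_eqVlt; apply/orP; left; apply/eqP; field.
have sub : ~: bad \subset G.
  apply/subsetP => z; rewrite !inE /= -leNgt /w /simeq /lesssim -/M.
  set r : R := _%:R => h.
  have : `|r - M| <= M / 2%:R.
    have M2 : 0 <= M / 2%:R by rewrite divr_ge0 ?ltW.
    rewrite -ler_sqr ?nnegrE ?normr_ge0 ?M2 //.
    rewrite real_normK ?num_real // (_ : (M / 2%:R) ^+ 2 = M ^+ 2 / 4%:R) //.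
    by field.
  by rewrite ler_norml => /andP[h1 h2]; apply/andP; split; lra.
have cG : #|~: bad|%:R <= #|G|%:R :> R by rewrite ler_nat subset_leq_card.
have := cardsC bad; rewrite card_mx muln1 => /(congr1 (fun n => n%:R : R)).
rewrite natrD natrX -/q => cb; lra.
Qed.
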